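(* Alternating Asynchronous Parity Automata (AAPA) are closed under union, intersection and complement, and the constructions are linear in the size of the input automata. That is, for any two AAPA $\mathcal{A}_1,\mathcal{A}_2$ with the same number $n$ of directions over the same finite alphabet $\Sigma$ there are AAPA of size $\mathcal{O}(|\mathcal{A}_1|+|\mathcal{A}_2|)$ recognising $\mathcal{L}(\mathcal{A}_1)\cup\mathcal{L}(\mathcal{A}_2)$ and $\mathcal{L}(\mathcal{A}_1)\cap\mathcal{L}(\mathcal{A}_2)$, and for every AAPA $\mathcal{A}$ there is an AAPA of size $\mathcal{O}(|\mathcal{A}|)$ recognising $(\Sigma^n)^\omega\setminus\mathcal{L}(\mathcal{A})$.
   Context: For a set $Q$, $\mathcal{B}^+(Q)$ denotes the positive Boolean formulas built from elements of $Q$ and $\mathit{true},\mathit{false}$ using $\wedge,\vee$; a set $Q'\subseteq Q$ satisfies such a formula if it evaluates to true when exactly the elements of $Q'$ are set to true. An AAPA with $n$ directions $M=\{1,\dots,n\}$ over a finite alphabet $\Sigma$ is a tuple $\mathcal{A}=(Q,\rho_0,\rho,\Omega)$ with $Q$ a finite non-empty set of states, $\rho_0\in\mathcal{B}^+(Q)$, $\rho:Q\times\Sigma\times M\to\mathcal{B}^+(Q)$ and priority function $\Omega:Q\to\{0,\dots,m\}$. It reads $n$ infinite words $w_1,\dots,w_n\in\Sigma^\omega$, identified with the single word over $\Sigma^n$ whose $i$-th letter is $(w_1(i),\dots,w_n(i))$ (positions indexed from $0$). A run is a $Q$-labelled tree $(T,r)$ ($T\subseteq\mathbb{N}^*$ prefix-closed,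 every node has at least one child) together with offset counters $c_1^t,\dots,c_n^t\in\mathbb{N}_0$ at each node $t$ such that: $c_i^t=0$ for all nodes $t$ of depth at most $1$; the set of labels of the children of the root satisfies $\rho_0$; and for every non-root node $t$ with children $t_1,\dots,t_k$ there is a direction $d\in M$ with $c_d^{t_j}=c_d^t+1$ and $c_{d'}^{t_j}=c_{d'}^t$ for all $j$ and $d'\neq d$, $1\le k\le|Q|$, and $\{r(t_1),\dots,r(t_k)\}$ satisfies $\rho(r(t),w_d(c_d^t),d)$. A run is accepting if on every infinite path the least priority occurring infinitely often is even. $\mathcal{L}(\mathcal{A})\subseteq(\Sigma^n)^\omega$ is the set of inputs admitting an accepting run. $|\mathcal{A}|$ denotes the size of the automaton.
   Formalization: For complement, the constant in O(|A|) may depend on the number n of directions (not on Σ or A); a constant independent of n is impossible for this notion of run, e.g. for the one-state automaton recognising ''some w_d is 1^ω''. Formulas are counted with shared subformulas. *)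

(* Defs.v *)
From HB Require Import structures.
From mathcomp Require Import all_boot.

Set Implicit Arguments.
Unset Strict Implicit.
Unset Printing Implicit Defensive.

Inductive pbf (Q : Type) : Type :=
| PTrue
| PFalse
| PAtom of Q
| PAnd of pbf Q & pbf Q
| POr of pbf Q & pbf Q.

Arguments PTrue {Q}.
Arguments PFalse {Q}.

Section PbfEq.
Variable Q : eqType.

Fixpoint pbf_encode (f : pbf Q) : GenTree.tree Q :=
  match f with
  | PTrue => GenTree.Node 0 [::]
  | PFalse => GenTree.Node 1 [::]
  | PAtom q => GenTree.Leaf q
  | PAnd g h => GenTree.Node 2 [:: pbf_encode g; pbf_encode h]
  | POr g h => GenTree.Node 3 [:: pbf_encode g; pbf_encode h]
  end.

Fixpoint pbf_decode (t : GenTree.tree Q) : pbf Q :=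
  match t with
  | GenTree.Node 0 _ => PTrue
  | GenTree.Leaf q => PAtom q
  | GenTree.Node 2 [:: a; b] => PAnd (pbf_decode a) (pbf_decode b)
  | GenTree.Node 3 [:: a; b] => POr (pbf_decode a) (pbf_decode b)
  | _ => PFalse
  end.

Lemma pbf_encodeK : cancel pbf_encode pbf_decode.
Proof. by elim=> //= [g -> h ->|g -> h ->]. Qed.

HB.instance Definition _ := Equality.copy (pbf Q) (can_type pbf_encodeK).
End PbfEq.

Fixpoint sat (Q : finType) (S : {set Q}) (f : pbf Q) : bool :=
  match f with
  | PTrue => true
  | PFalse => false
  | PAtom q => q \in S
  | PAnd g h => sat S g && sat S h
  | POr g h => sat S g || sat S h
  end.

Fixpoint subformulas (Q : Type) (f : pbf Q) : seq (pbf Q) :=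
  f :: match f with
       | PAnd g h | POr g h => subformulas g ++ subformulas h
       | _ => [::]
       end.

Record aapa (n : nat) (Sigma : finType) := Aapa {
  state : finType;
  state_nonempty : 0 < #|state|;
  max_prio : nat;
  init : pbf state;
  trans : state -> Sigma -> 'I_n -> pbf state;
  prio : state -> 'I_max_prio.+1
}.

Section Semantics.
Variables (n : nat) (Sigma : finType).
Implicit Types (A : aapa n Sigma) (w : nat -> n.-tuple Sigma).

(* Size of an explicit description of A: its states, its priorities, the
   entries of the transition table, and the distinct subformulas of the
   formulas in it (i.e. formulas are stored as DAGs sharing equal
   subformulas). *)
Definition formulas A : seq (pbf (state A)) :=
  init A :: [seq trans x.1.1 x.1.2 x.2 | x : state A * Sigma * 'I_n].

Definition aapa_size A : nat :=
  #|state A| + (max_prio A).+1 + #|state A| * #|Sigma| * n +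
  size (undup (flatten (map (@subformulas (state A)) (formulas A)))).

(* The children of the node t of the tree T are the nodes rcons t i in T. *)
Definition children_satisfy A (T : seq nat -> Prop) (r : seq nat -> state A)
    (t : seq nat) (f : pbf (state A)) : Prop :=
  exists2 S : {set state A},
    forall q, q \in S <-> exists2 i, T (rcons t i) & r (rcons t i) = q
    & sat S f.

(* c t d is the offset counter of direction d at node t.  The values of r and
   c outside T are irrelevant. *)
Record is_run A w (T : seq nat -> Prop) (r : seq nat -> state A)
    (c : seq nat -> 'I_n -> nat) : Prop := IsRun {
  run_root : T [::];
  run_prefix : forall s t, T (s ++ t) -> T s;
  run_child : forall t, T t -> exists i, T (rcons t i);
  run_count0 : forall t, T t -> size t <= 1 -> forall d, c t d = 0;
  run_init : children_satisfy T r [::] (init A);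
  run_step : forall t, T t -> t != [::] -> exists d : 'I_n,
    [/\ forall i, T (rcons t i) ->
          forall d', c (rcons t i) d' = if d' == d then (c t d).+1 else c t d',
        exists s : seq nat,
          [/\ uniq s, forall i, T (rcons t i) <-> i \in s
            & 1 <= size s <= #|state A|]
      & children_satisfy T r t (trans (r t) (tnth (w (c t d)) d) d)]
}.

Definition infinitely_often (P : nat -> Prop) : Prop :=
  forall N, exists2 k, N <= k & P k.

(* An infinite path is given by its child indices pi; its k-th node is
   mkseq pi k. *)
Definition accepting A (T : seq nat -> Prop) (r : seq nat -> state A) : Prop :=
  forall pi : nat -> nat, (forall k, T (mkseq pi k)) ->
  let occurs p :=
    infinitely_often (fun k => prio (r (mkseq pi k)) = p :> nat) in
  exists p, [/\ occurs p, forall p', occurs p' -> p <= p' & ~~ odd p].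

Definition lang A w : Prop :=
  exists T (r : seq nat -> state A) c,
    @is_run A w T r c /\ @accepting A T r.

End Semantics.

(* Main.v *)
(** A run is a strategy of the first player of an infinite parity game: from a
    state with offset counters she chooses a direction and a non-empty set of
    states satisfying the transition formula, and her opponent chooses one of
    these states.  Since every node of a run has a child, formulas must be
    satisfied by non-empty sets of states; for instance an automaton whose
    formulas are all [PTrue] accepts nothing if its priorities are odd.  So
    the union and the intersection replace a formula [f] of one automaton by
    [f /\ \/_q q], the disjunction over the states of this automaton.

    In the complement the opponent also has to choose the direction, before
    the first player knows which one it is.  This is encoded in the states: an
    atom [q] of the dual formula becomes the conjunction of the states
    [(q, d)] over all directions [d], and [(q, d)] can only read direction
    [d].  An accepting sink makes non-emptiness harmless, and priorities are
    shifted by one.  Its correctness is the determinacy of parity games, shown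
    by induction on the least priority [p].  If [p] is good for player [b],
    let [W] be the positions won by the other player, and replace the
    positions of priority [p] outside [W] by exits won by [b], those in [W] by
    exits won by the opponent.  The opponent wins the new game only from [W].
    So everywhere else [b] wins it, and restarting the strategy after each
    exit [b] either visits [p] infinitely often or eventually stays in a play
    won in the new game. *)

Require Import Defs.
From HB Require Import structures.
From mathcomp Require Import all_boot zify.
From Stdlib Require Import Classical ClassicalEpsilon Eqdep.

Set Implicit Arguments.
Unset Strict Implicit.
Unset Printing Implicit Defensive.

(** * Choice and the parity condition on sequences *)

Lemma choice_fun (A B : Type) (R : A -> B -> Prop) :
  (forall x, exists y, R x y) -> exists f, forall x, R x (f x).
Proof.
move=> RA; exists (fun x => proj1_sig (constructive_indefinite_description _ (RA x))).
by move=> x; case: constructive_indefinite_description.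
Qed.

Lemma neq_negb (b c : bool) : c != b -> c = ~~ b.
Proof. by case: b; case: c. Qed.

Definition parity_acc (b : bool) (f : nat -> nat) : Prop :=
  exists p, [/\ infinitely_often (fun k => f k = p),
    forall p', infinitely_often (fun k => f k = p') -> p <= p' & odd p = b].

Lemma infinitely_often_shift (P Q : nat -> Prop) K :
  (forall k, P (k + K) <-> Q k) -> infinitely_often P <-> infinitely_often Q.
Proof.
move=> PQ; split=> io N.
- have [k leNK Pk] := io (N + K).
  have leKk : K <= k by apply: leq_trans leNK; apply: leq_addl.
  exists (k - K); first by rewrite -(leq_add2r K) subnK.
  by apply/PQ; rewrite subnK.
- by have [k leNk /PQ Pk] := io N; exists (k + K) => //; apply: leq_trans leNk (leq_addr _ _).
Qed.

(** Recurrence ignores finite prefixes, and a priority recurring in [f] is at least [e] because [f]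
    is so from position [K] on. *)
Lemma parity_acc_shift b b' (f g : nat -> nat) K e :
  (forall k, f (k + K) = g k + e) -> b = odd e (+) b' ->
  parity_acc b' g -> parity_acc b f.
Proof.
move=> fg -> [p [iop minp <-]]; exists (p + e); split; last by rewrite oddD addbC.
- apply/(@infinitely_often_shift _ (fun k => g k = p) K) => // k.
  by rewrite fg; split=> [/addIn|->].
- move=> p' iop'.
  have lep' : e <= p'.
    by have [k leKk <-] := iop' K; rewrite -(subnK leKk) fg leq_addl.
  rewrite -(subnK lep') leq_add2r; apply: minp.
  apply/(@infinitely_often_shift (fun k => f k = p') _ K) => // k.
  rewrite fg; split=> [<-|->]; [by rewrite addnK | by rewrite subnK].
Qed.

Lemma parity_acc_suffix b (f g : nat -> nat) K :
  (forall k, f (k + K) = g k) -> parity_acc b g -> parity_acc b f.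
Proof. by move=> fg; apply: (parity_acc_shift (e := 0)) => [k|//]; rewrite addn0. Qed.

Lemma parity_acc_uniq b b' f : parity_acc b f -> parity_acc b' f -> b = b'.
Proof.
move=> [p [iop minp <-]] [q [ioq minq <-]].
by congr odd; apply/eqP; rewrite eqn_leq minp ?minq.
Qed.

Lemma parity_acc_least f p :
  (forall k, p <= f k) -> infinitely_often (fun k => f k = p) ->
  parity_acc (odd p) f.
Proof.
move=> lepf iop; exists p; split=> // p' /(_ 0)[k _ <-].
exact: lepf.
Qed.

(** * Games given by forcing operators, and their strategies *)

Definition monotone (V : Type) (F : V -> (V -> Prop) -> Prop) : Prop :=
  forall v (X Y : V -> Prop), (forall u, X u -> Y u) -> F v X -> F v Y.

(** [F v X] says that the player can force the next position after [v] into
    [X].  Positions in [U] are exits won by the player, and the game is only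
    played on [D].  The nodes of a strategy are its memory states, so that it
    need not be positional. *)
Record strategy (V : Type) (F : V -> (V -> Prop) -> Prop) (pr : V -> nat)
    (b : bool) (D U : V -> Prop) := Strategy {
  node : Type;
  pos : node -> V;
  edge : node -> node -> Prop;
  strategy_dom : forall x, D (pos x);
  strategy_step : forall x,
    F (pos x) (fun u => U u \/ exists2 y, edge x y & pos y = u);
  strategy_acc : forall p : nat -> node, (forall k, edge (p k) (p k.+1)) ->
    parity_acc b (fun k => pr (pos (p k)))
}.

Definition wins V (F : V -> (V -> Prop) -> Prop) pr b (D U : V -> Prop) v : Prop :=
  U v \/ exists (G : strategy F pr b D U) (x : node G), pos x = v.

Section Strategies.
Variables (V : Type) (F : V -> (V -> Prop) -> Prop) (pr : V -> nat) (b : bool).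
Hypothesis Fmono : monotone F.
Implicit Types (D U : V -> Prop).

Lemma empty_strategy D U : strategy F pr b D U.
Proof.
have accE (p : nat -> False) : (nat -> False) -> parity_acc b (fun k => pr (match p k with end)).
  by case: (p 0).
exact: (@Strategy _ F pr b D U False (fun x => match x with end) (fun _ _ => False)
  (fun x => match x with end) (fun x => match x with end) accE).
Qed.

(** Take the disjoint union of one strategy per position, the empty one where none is available.
    Edges stay inside a component, so every play is a play of a single strategy. *)
Lemma uniform_strategy D U : exists G : strategy F pr b D U,
  forall v, wins F pr b D U v -> U v \/ exists x : node G, pos x = v.
Proof.
have [g gP] : exists g : V -> strategy F pr b D U,
    forall v, wins F pr b D U v -> U v \/ exists x : node (g v), pos x = v.
  apply: (@choice_fun _ _ (fun v (G : strategy F pr b D U) =>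
    wins F pr b D U v -> U v \/ exists x : node G, pos x = v)) => v.
  have [[Uv|[G wG]]|lose] := classic (wins F pr b D U v).
  - suff G : strategy F pr b D U by exists G; left.
    exact: empty_strategy.
  - by exists G; right.
  - suff G : strategy F pr b D U by exists G.
    exact: empty_strategy.
pose N := {v : V & node (g v)}.
pose P (z : N) := pos (projT2 z).
pose E (z z' : N) := exists (v : V) (x y : node (g v)),
  [/\ z = existT _ v x, z' = existT _ v y & edge x y].
have stepE z : F (P z) (fun u => U u \/ exists2 y, E z y & P y = u).
  case: z => v x; apply: Fmono (strategy_step x) => u [Uu|[y xy <-]]; first by left.
  by right; exists (existT _ v y) => //; exists v, x, y.
have accE (p : nat -> N) : (forall k, E (p k) (p k.+1)) ->
    parity_acc b (fun k => pr (P (p k))).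
  move=> pE; have [v pv] : exists v, forall k, exists x, p k = existT _ v x.
    exists (projT1 (p 0)); elim=> [|k [x pk]]; first by case: (p 0) => v x; exists x.
    have [v [x1 [y [e1 e2 _]]]] := pE k; rewrite e2.
    by move: (congr1 (@projT1 _ _) e1); rewrite pk /= => ->; exists y.
  have [q pq] := choice_fun pv.
  apply: (@parity_acc_suffix _ _ (fun k => pr (pos (q k))) 0) => [k|].
    by rewrite addn0 pq.
  apply: strategy_acc => k; have [v' [x [y [e1 e2 xy]]]] := pE k.
  rewrite !pq in e1 e2.
  have ev : v = v' by have := congr1 (@projT1 _ _) e1.
  subst v'; by rewrite (inj_pair2 _ _ _ _ _ e1) (inj_pair2 _ _ _ _ _ e2).
exists (Strategy (fun z => strategy_dom (projT2 z)) stepE accE) => v /gP[Uv|[x <-]]; first by left.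
by right; exists (existT _ v x).
Qed.

(** Play [G] until it exits into [U], then follow a uniform strategy of the second game. As [E]
    never leads back, a play switches at most once and has a suffix in one of the two strategies. *)
Lemma wins_trans D D' U U' v :
  (forall u, D u -> D' u) -> (forall u, U u -> wins F pr b D' U' u) ->
  wins F pr b D U v -> wins F pr b D' U' v.
Proof.
move=> DD' UU' [Uv|[G [x0 x0v]]]; first exact: UU'.
have [H HP] := uniform_strategy D' U'.
pose P (z : node G + node H) := match z with inl x => pos x | inr y => pos y end.
pose E (z z' : node G + node H) := match z, z' with
  | inl x, inl x' => edge x x' | inl _, inr _ => True
  | inr y, inr y' => edge y y' | inr _, inl _ => False end.
have domE z : D' (P z).
  by case: z => [x|y]; [apply: DD'; apply: strategy_dom | apply: strategy_dom].
have stepE z : F (P z) (fun u => U' u \/ exists2 z', E z z' & P z' = u).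
  case: z => [x|y]; apply: Fmono (strategy_step _) => u /=.
  - case=> [/UU'/HP[|[y yu]]|[x' xx' <-]]; first by left.
      by right; exists (inr y).
    by right; exists (inl x').
  - case=> [|[y' yy' <-]]; first by left.
    by right; exists (inr y').
have accE (p : nat -> node G + node H) : (forall k, E (p k) (p k.+1)) ->
    parity_acc b (fun k => pr (P (p k))).
  move=> pE; have [[K [y0 pK]]|allG] := classic (exists K y, p K = inr y).
    have pinr k : exists y, p (k + K) = inr y.
      elim: k => [|k [y pk]]; first by exists y0.
      by have := pE (k + K); rewrite pk addSn; case: (p _) => // y' _; exists y'.
    have [q pq] := choice_fun pinr.
    apply: (@parity_acc_suffix _ _ (fun k => pr (pos (q k))) K) => [k|].
      by rewrite pq.
    by apply: strategy_acc => k; have := pE (k + K); rewrite -addSn !pq.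
  have pinl k : exists x, p k = inl x.
    by case pk: (p k) => [x|y]; [exists x | case: allG; exists k, y].
  have [q pq] := choice_fun pinl.
  apply: (@parity_acc_suffix _ _ (fun k => pr (pos (q k))) 0) => [k|].
    by rewrite addn0 pq.
  by apply: strategy_acc => k; have := pE k; rewrite !pq.
by right; exists (Strategy domE stepE accE), (inl x0).
Qed.

(** A strategy with one node and no edges exits into the winning region at once. *)
Lemma wins_step D U v : D v -> F v (wins F pr b D U) -> wins F pr b D U v.
Proof.
move=> Dv Fv; apply: (@wins_trans D D (wins F pr b D U)) => //; right.
have stepE (x : unit) :
    F v (fun u => wins F pr b D U u \/ exists2 y : unit, False & v = u).
  by apply: Fmono Fv; left.
have accE (p : nat -> unit) : (nat -> False) -> parity_acc b (fun k => pr v).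
  by move/(_ 0).
by exists (@Strategy _ F pr b D _ unit (fun=> v) (fun _ _ => False) (fun=> Dv) stepE accE), tt.
Qed.

End Strategies.

(** * Determinacy of parity games *)

Section Determinacy.
Variables (V : Type) (F : bool -> V -> (V -> Prop) -> Prop) (pr : V -> nat).
Hypothesis Fmono : forall b, monotone (F b).
Hypothesis Fdual : forall b v X, F b v X \/ F (~~ b) v (fun u => ~ X u).

Let dom (U : bool -> V -> Prop) u := forall c, ~ U c u.

Lemma wins_least_priority (U : bool -> V -> Prop) (p : nat) :
  let b := odd p in
  let W := wins (F (~~ b)) pr (~~ b) (dom U) (U (~~ b)) in
  let A u := U b u \/ [/\ dom U u, pr u = p & ~ W u] in
  let D u := ~ W u /\ ~ A u in
  (forall v, dom U v -> p <= pr v) ->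
  (forall v, W v \/ wins (F b) pr b D A v) ->
  forall v, W v \/ wins (F b) pr b (dom U) (U b) v.
Proof.
move=> b W A D lep det v.
have [Wv|nWv] := classic (W v); [by left | right].
have [H HP] := uniform_strategy pr b (@Fmono b) D A.
have domD u : D u -> dom U u.
  move=> [nW nA] c Uc; case: (eqVneq c b) Uc => [-> Ub|]; first by apply: nA; left.
  by move=> /neq_negb -> Ub; apply: nW; left.
(* The nodes of [L] are the restart points: a play through them infinitely often sees [p], the least
   priority, again and again; any other play finally stays in [H]. *)
pose L := {u | [/\ dom U u, pr u = p & ~ W u]}.
pose P (z : L + node H) := match z with inl x => proj1_sig x | inr y => pos y end.
pose E (z z' : L + node H) := match z, z' with
  | inr x, inr y => edge x y | _, _ => True end.
have A_P u : A u -> U b u \/ exists2 z : L, True & P (inl z) = u.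
  by case=> [|Lu]; [left | right; exists (exist _ u Lu)].
have domE z : dom U (P z).
  by case: z => [[u []]|y] //; apply: domD; apply: strategy_dom.
have stepE z : F b (P z) (fun u => U b u \/ exists2 z', E z z' & P z' = u).
  case: z => [[u [domu pru nWu]]|y] /=.
  (* If the opponent could force [W] from [u], then [u] would lie in [W]. So [b] can avoid [W], and
     [det] covers every position outside [W]. *)
  - have [FW|] := Fdual (~~ b) u W; first by case: nWu; apply: (wins_step (@Fmono (~~ b)) domu).
    rewrite negbK; apply: Fmono => u' nWu'.
    have [//|/HP[/A_P[|[z _ zu]]|[y yu]]] := det u'; first by left.
      by right; exists (inl z).
    by right; exists (inr y).
  - apply: Fmono (strategy_step _) => u [/A_P[|[z _ zu]]|[y' yy' <-]]; first by left.
      by right; exists (inl z).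
    by right; exists (inr y').
have accE (q : nat -> L + node H) : (forall k, E (q k) (q k.+1)) ->
    parity_acc b (fun k => pr (P (q k))).
  move=> qE; have [io|nio] := classic (infinitely_often (fun k => pr (P (q k)) = p)).
    by apply: parity_acc_least => // k; apply: lep; apply: domE.
  have [K inrK] : exists K, forall k, exists y, q (k + K) = inr y.
    apply: NNPP => noK; apply: nio => N; apply: NNPP => nN; apply: noK.
    exists N => k; case qk: (q (k + N)) => [z|y]; last by exists y.
    case: nN; exists (k + N); first exact: leq_addl.
    by rewrite qk; case: (z) => u [].
  have [r qr] := choice_fun inrK.
  apply: (@parity_acc_suffix _ _ (fun k => pr (pos (r k))) K) => [k|].
    by rewrite qr.
  by apply: strategy_acc => k; have := qE (k + K); rewrite -addSn !qr.
have [//|/HP[/A_P[|[z _ <-]]|[y <-]]] := det v; first by left.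
  by right; exists (Strategy domE stepE accE), (inl z).
by right; exists (Strategy domE stepE accE), (inr y).
Qed.

(** Induction on [k]: for [k = 0] no priority is left and every position is an exit, and each step
    admits the priority [m - k.+1] as a new least one. *)
Lemma wins_determined_above (m : nat) : (forall v, pr v < m) ->
  forall k (U : bool -> V -> Prop), (forall v, dom U v -> m - k <= pr v) ->
  forall v, wins (F true) pr true (dom U) (U true) v \/
            wins (F false) pr false (dom U) (U false) v.
Proof.
move=> ltm; elim=> [|k IHk] U lek v.
  suff [c Uc] : exists c, U c v by case: c Uc; [left|right]; left.
  apply: NNPP => nU; have : dom U v by move=> c Uc; apply: nU; exists c.
  by move/lek; rewrite subn0 leqNgt ltm.
pose p := m - k.+1; pose b := odd p.
pose W := wins (F (~~ b)) pr (~~ b) (dom U) (U (~~ b)).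
pose A u := U b u \/ [/\ dom U u, pr u = p & ~ W u].
have detb u : wins (F (~~ b)) pr (~~ b) (dom U) (U (~~ b)) u \/
              wins (F b) pr b (dom U) (U b) u.
  apply: (@wins_least_priority U p) => // {}u; rewrite -/b -/W -/A.
  (* The exits of the smaller game. Its domain retains only priorities above [p], since a position
     of priority [p] lies in [W] or in [A]. *)
  pose U' c := if c == b then A else W.
  have U'dom w : dom U' w <-> ~ W w /\ ~ A w.
    rewrite /dom /U'; split=> [nU'|[nW nA] c]; last by case: eqP.
    by split=> [Ww|Aw]; [apply: (nU' (~~ b)) | apply: (nU' b)];
      rewrite ?eqxx // -addTb; case: (b).
  have subdom w : dom U' w -> dom U w.
    move=> /U'dom[nW nA] c Uc; apply: nW; left.
    have [cb|] := eqVneq c b; first by case: nA; left; rewrite -cb.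
    by move=> /neq_negb <-.
  (* Exits in [W] are already won by the opponent in the old game, so whatever the opponent wins in
     the smaller game lies in [W] too. *)
  have wU' c : wins (F c) pr c (dom U') (U' c) u -> W u \/
      wins (F b) pr b (fun w => ~ W w /\ ~ A w) A u.
    rewrite /U'; have [->|cb] := eqVneq c b.
      move=> wA; right; apply: (wins_trans (@Fmono b)) wA => [w /U'dom|w Aw] //.
      by left.
    rewrite (neq_negb cb).
    by move=> wW; left; apply: (wins_trans (@Fmono (~~ b))) wW.
  have [|/wU' //|/wU' //] := IHk U' _ u.
  move=> w /[dup] /subdom domw /U'dom[nWw nAw].
  have := lek w domw; rewrite -/p leq_eqVlt => /orP[/eqP pw|].
    by case: nAw; right.
  by apply: leq_trans; rewrite /p; case: (ltnP k m) => [ltk|lemk];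
    [rewrite subnSK | rewrite (eqP lemk)].
by have := detb v; case: (b) => [] [] /=; [right|left|left|right].
Qed.

End Determinacy.

Definition everywhere (V : Type) (_ : V) : Prop := True.
Definition nowhere (V : Type) (_ : V) : Prop := False.

Theorem parity_determinacy (V : Type) (F : bool -> V -> (V -> Prop) -> Prop)
    (pr : V -> nat) (m : nat) :
  (forall b, monotone (F b)) ->
  (forall b v X, F b v X \/ F (~~ b) v (fun u => ~ X u)) ->
  (forall v, pr v < m) -> forall b v,
  wins (F b) pr b (@everywhere V) (@nowhere V) v \/
  wins (F (~~ b)) pr (~~ b) (@everywhere V) (@nowhere V) v.
Proof.
move=> Fmono Fdual ltm b v.
have wU c : wins (F c) pr c (fun u => forall c', ~ (fun=> @nowhere V) c' u)
    (@nowhere V) v -> wins (F c) pr c (@everywhere V) (@nowhere V) v.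
  by apply: wins_trans => // u [].
have [|/wU w|/wU w] := wins_determined_above Fmono Fdual ltm (k := m)
  (U := fun=> @nowhere V) _ v; first by rewrite subnn.
  by case: b; [left|right].
by case: b; [right|left].
Qed.

(** * Transfer of strategies between games *)

Notation wins_all F pr b := (wins F pr b (@everywhere _) (@nowhere _)).

(** The new memory pairs a node of the old strategy with a related position, so priorities along
    corresponding plays differ by [e]. A move may also leave for a position already won;
    [wins_trans] completes such plays. *)
Lemma wins_simulation (V V' : Type) (F : V -> (V -> Prop) -> Prop)
    (F' : V' -> (V' -> Prop) -> Prop) (pr : V -> nat) (pr' : V' -> nat)
    (b b' : bool) (e : nat) (R : V -> V' -> Prop) :
  monotone F -> monotone F' -> b' = odd e (+) b ->
  (forall v v', R v v' -> pr' v' = pr v + e) ->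
  (forall v v' X, R v v' -> F v X -> F' v' (fun u' =>
     wins_all F' pr' b' u' \/ exists2 u, X u & R u u')) ->
  forall v v', R v v' -> wins_all F pr b v -> wins_all F' pr' b' v'.
Proof.
move=> Fmono F'mono b'E prE simR v v' Rvv' [[]|[G [x xv]]].
apply: (wins_trans F'mono (D := @everywhere V') (U := wins_all F' pr' b')) => //.
pose N := {z : node G * V' | R (pos z.1) z.2}.
pose P (z : N) := (proj1_sig z).2.
pose E (z z' : N) := edge (proj1_sig z).1 (proj1_sig z').1.
have stepE z : F' (P z) (fun u =>
    wins_all F' pr' b' u \/ exists2 z', E z z' & P z' = u).
  case: z => [[y u'] /= Ryu']; have := simR _ _ _ Ryu' (strategy_step y).
  apply: F'mono => w' [|[w [[]|[y' yy' <-]] Rw]]; first by left.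
  by right; exists (exist _ (y', w') Rw).
have accE (p : nat -> N) : (forall k, E (p k) (p k.+1)) ->
    parity_acc b' (fun k => pr' (P (p k))).
  move=> pE.
  apply: (@parity_acc_shift _ b _ (fun k => pr (pos (proj1_sig (p k)).1)) 0 e) => //.
    by move=> k; rewrite addn0 (prE _ _ (proj2_sig (p k))).
  exact: strategy_acc.
right; subst v.
by exists (@Strategy _ F' pr' b' _ _ N P E (fun=> I) stepE accE), (exist _ (x, v') Rvv').
Qed.

(** * Runs as strategies in the acceptance game *)

Definition force (Q : finType) (f : pbf Q) (Z : Q -> Prop) : Prop :=
  exists S : {set Q}, [/\ S != set0, sat S f & forall q, q \in S -> Z q].

Lemma sat_mono (Q : finType) (f : pbf Q) (S S' : {set Q}) :
  S \subset S' -> sat S f -> sat S' f.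
Proof.
move=> sSS'; elim: f => //= [q|g IHg h IHh|g IHg h IHh]; first exact: (subsetP sSS').
  by case/andP=> /IHg-> /IHh.
by case/orP=> [/IHg->//|/IHh->]; rewrite orbT.
Qed.

Lemma force_mono (Q : finType) (f : pbf Q) (Z Z' : Q -> Prop) :
  (forall q, Z q -> Z' q) -> force f Z -> force f Z'.
Proof. by move=> ZZ' [S [S0 Sf SZ]]; exists S; split=> // q /SZ/ZZ'. Qed.

Section AcceptanceGame.
Variables (n : nat) (Sigma : finType) (A : aapa n Sigma) (w : nat -> n.-tuple Sigma).

(** Finite functions make counters with the same values equal, as matching positions requires. *)
Definition advance (c : {ffun 'I_n -> nat}) (d : 'I_n) : {ffun 'I_n -> nat} :=
  [ffun d' => if d' == d then (c d).+1 else c d'].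

Definition letter (c : {ffun 'I_n -> nat}) (d : 'I_n) : Sigma := tnth (w (c d)) d.

Definition position := (state A * {ffun 'I_n -> nat})%type.

Definition run_move (v : position) (X : position -> Prop) : Prop :=
  exists d, force (trans v.1 (letter v.2 d) d) (fun q => X (q, advance v.2 d)).

Definition position_prio (v : position) : nat := prio v.1.

Definition accepts_from (v : position) : Prop :=
  wins_all run_move position_prio false v.

Definition start : {ffun 'I_n -> nat} := [ffun => 0].

Lemma run_move_mono : monotone run_move.
Proof. by move=> v X Y XY [d Fd]; exists d; apply: force_mono Fd => q; apply: XY. Qed.

(** Entry [j] is settled once the chain is longer than [j], and [t j.+1] is long enough, so one
    index sequence has all these nodes as prefixes. *)
Lemma mkseq_nth_chain (t : nat -> seq nat) :
  (forall k, exists i, t k.+1 = rcons (t k) i) ->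
  let pi := fun j => nth 0 (t j.+1) j in
  forall k, mkseq pi (k + size (t 0)) = t k.
Proof.
move=> tS pi.
have szt k : size (t k) = k + size (t 0).
  by elim: k => // k; have [i ->] := tS k; rewrite size_rcons => ->.
have nth_t k l j : j < size (t k) -> nth 0 (t (k + l)) j = nth 0 (t k) j.
  move=> ltj; elim: l => [|l <-]; first by rewrite addn0.
  rewrite addnS; have [i ->] := tS (k + l); rewrite nth_rcons ifT //.
  by rewrite szt (leq_trans ltj) // szt leq_add2r leq_addr.
move=> k; apply: (@eq_from_nth _ 0); first by rewrite size_mkseq szt.
move=> j; rewrite size_mkseq => ltj; rewrite nth_mkseq // /pi.
have ltj1 : j < size (t j.+1) by rewrite szt ltn_addr.
by case/orP: (leq_total k j.+1) => [/subnKC <-|/subnKC <-]; rewrite nth_t // szt.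
Qed.

(** The tree without its root serves as the memory of a strategy. *)
Lemma lang_force : lang A w -> force (init A) (fun q => accepts_from (q, start)).
Proof.
move=> [T [r [c [Trun Tacc]]]].
case: Trun => Troot Tprefix Tchild Tcount [S SE Sinit] Tstep.
exists S; split=> //.
  have [i Ti] := Tchild _ Troot; apply/set0Pn; exists (r (rcons [::] i)).
  by apply/SE; exists i.
move=> q /SE[i Ti riq]; right.
pose N := {t | T t /\ t != [::]}.
pose P (z : N) : position := (r (proj1_sig z), [ffun d => c (proj1_sig z) d]).
pose E (z z' : N) := exists i, proj1_sig z' = rcons (proj1_sig z) i.
have stepE z : run_move (P z) (fun u => nowhere u \/ exists2 y, E z y & P y = u).
  case: z => t [Tt t0]; have [d [cd _ [S' S'E S'f]]] := Tstep t Tt t0.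
  exists d; exists S'; split=> /=.
  - have [j Tj] := Tchild _ Tt; apply/set0Pn; exists (r (rcons t j)).
    by apply/S'E; exists j.
  - by rewrite /letter ffunE.
  - move=> q' /S'E[j Tj rjq']; right.
    have j0 : rcons t j != [::] by case: (t).
    exists (exist _ (rcons t j) (conj Tj j0)); first by exists j.
    by rewrite /P /= rjq'; congr pair; apply/ffunP=> d'; rewrite !ffunE cd.
have accE (p : nat -> N) : (forall k, E (p k) (p k.+1)) ->
    parity_acc false (fun k => position_prio (P (p k))).
  (* The play starts at depth [K], so it is a suffix of a path of the tree; the earlier nodes of the
     path lie in [T] by prefix closure. *)
  move=> pE; have piE := mkseq_nth_chain (t := fun k => proj1_sig (p k)) pE.
  set pi := (fun j => nth 0 _ j) in piE; set K := size _ in piE.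
  suff [p0 [io least even]] : parity_acc false (fun k => prio (r (mkseq pi k))).
    exists p0; split=> //.
      apply: (infinitely_often_shift (K := K) _).1 io => k.
      by rewrite piE.
    move=> p' iop'; apply: least.
    by apply: (infinitely_often_shift (K := K) _).2 iop' => k; rewrite piE.
  have [|p0 [io least even]] := Tacc pi.
    move=> k; have [leKk|ltkK] := leqP K k.
      by rewrite -(subnK leKk) piE; case: (proj2_sig (p (k - K))).
    apply: (Tprefix _ (drop k (mkseq pi K))).
    have -> : mkseq pi k = take k (mkseq pi K).
      by rewrite /mkseq -map_take take_iota (minn_idPl (ltnW ltkK)).
    rewrite cat_take_drop; have := piE 0; rewrite add0n => ->.
    by case: (proj2_sig (p 0)).
  by exists p0; split=> //; apply: negbTE.
exists (@Strategy _ run_move position_prio false _ _ N P E (fun=> I) stepE accE).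
exists (exist _ (rcons [::] i) (conj Ti isT)).
by rewrite /P /= riq; congr pair; apply/ffunP=> d; rewrite !ffunE Tcount.
Qed.


(** Unfold a uniform strategy into a tree: each tree node carries a memory node, and its children
    are indexed by an enumeration of the states. *)
Lemma force_lang : force (init A) (fun q => accepts_from (q, start)) -> lang A w.
Proof.
move=> [S0 [S0n0 S0init S0acc]].
have /set0Pn[q0 q0S] := S0n0.
have [G GP] := uniform_strategy position_prio false run_move_mono
  (@everywhere position) (@nowhere position).
have acc_node v : accepts_from v -> exists x : node G, pos x = v.
  by case/GP.
have [x0 _] := acc_node _ (S0acc _ q0S).
(* A move consists of the chosen states, the next memory node for each of them, and the direction
   read. [None] stands for the root, where no direction is read. *)
pose legal (y : option (node G)) (m : {set state A} * (state A -> node G) * option 'I_n) :=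
  let: (S1, nx, od) := m in
  S1 != set0 /\ match y, od with
  | Some x, Some d => sat S1 (trans (pos x).1 (letter (pos x).2 d) d) /\
     forall q, q \in S1 -> edge x (nx q) /\ pos (nx q) = (q, advance (pos x).2 d)
  | None, _ => sat S1 (init A) /\ forall q, q \in S1 -> pos (nx q) = (q, start)
  | Some _, None => False
  end.
have [m mP] : exists m, forall y, legal y (m y).
  apply: choice_fun => -[x|].
    have [d [S [Sn0 Sf SX]]] := strategy_step x.
    have [nx nxP] : exists nx : state A -> node G, forall q, q \in S ->
        edge x (nx q) /\ pos (nx q) = (q, advance (pos x).2 d).
      apply: (@choice_fun _ _ (fun q y => q \in S ->
        edge x y /\ pos y = (q, advance (pos x).2 d))) => q.
      have [qS|] := boolP (q \in S); last by exists x.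
      by have [[]|[y xy yq]] := SX q qS; exists y.
    by exists (S, nx, Some d).
  have [nx nxP] : exists nx : state A -> node G, forall q, q \in S0 ->
      pos (nx q) = (q, start).
    apply: (@choice_fun _ _ (fun q y => q \in S0 -> pos y = (q, start))) => q.
    have [qS|] := boolP (q \in S0); last by exists x0.
    by have [y yq] := acc_node _ (S0acc _ qS); exists y.
  by exists (S0, nx, None).
pose S y := (m y).1.1; pose nx y q := Some ((m y).1.2 q).
(* The default [q0] only labels indices out of range, which [ok] excludes. *)
pose lab i := nth q0 (enum (state A)) i.
pose nodeat t := foldl (fun y i => nx y (lab i)) None t.
pose ok y i := (i < #|state A|) && (lab i \in S y).
pose T t := forall s i u, t = rcons s i ++ u -> ok (nodeat s) i.
have T_rcons t i : T (rcons t i) <-> T t /\ ok (nodeat t) i.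
  split=> [Tti|[Tt okti] s j u].
    split=> [s j u tE|]; last by apply: (Tti _ _ [::]); rewrite cats0.
    by apply: (Tti _ _ (rcons u i)); rewrite tE rcons_cat.
  case/lastP: u => [|u k]; first by rewrite cats0 => /rcons_inj[<- <-].
  by rewrite -rcons_cat => /rcons_inj[tE _]; apply: Tt tE.
have nodeat_rcons t i : nodeat (rcons t i) = nx (nodeat t) (lab i).
  by rewrite /nodeat -cats1 foldl_cat.
have ok_ex t q : q \in S (nodeat t) -> exists2 i, ok (nodeat t) i & lab i = q.
  move=> qS; exists (index q (enum (state A))); last by rewrite /lab nth_index ?mem_enum.
  by rewrite /ok /lab nth_index ?mem_enum // qS andbT cardE index_mem mem_enum.
(* The root has no memory node; its label is arbitrary, but its offsets must be zero. *)
pose v t := if nodeat t is Some x then pos x else (q0, start).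
have lab_v t i : ok (nodeat t) i -> (v (rcons t i)).1 = lab i.
  rewrite /v nodeat_rcons /nx => /andP[_]; have := mP (nodeat t); rewrite /S.
  case: (m _) => [[S1 nx1] od] /= [_]; case: (nodeat t) => [x|].
    by case: od => // d [_ nxP] /nxP[_ ->].
  by case=> _ nxP /nxP->.
have T_S t : T t -> forall q,
    q \in S (nodeat t) <-> exists2 i, T (rcons t i) & (v (rcons t i)).1 = q.
  move=> Tt q; split=> [/ok_ex[i oki <-]|[i /T_rcons[_ oki] <-]].
    by exists i; [apply/T_rcons | apply: lab_v].
  by rewrite lab_v //; case/andP: oki.
exists T, (fun t => (v t).1), (fun t d => (v t).2 d); split; first split.
- by case.
- by move=> s t Tst s1 i u sE; apply: (Tst _ _ (u ++ t)); rewrite sE catA.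
- move=> t Tt; have [/set0Pn[q /ok_ex[i oki _]] _] : S (nodeat t) != set0 /\ True.
    by have := mP (nodeat t); rewrite /S; case: (m _) => [[S1 nx1] od] [].
  by exists i; apply/T_rcons.
- case=> [|i [|//]] Tt _ d; first by rewrite /v /= ffunE.
  have /T_rcons[_ /andP[_ iS]] : T (rcons [::] i) by [].
  have := mP None; rewrite /v /= /nx; move: iS; rewrite /S /=.
  by case: (m None) => [[S1 nx1] od] /= iS [_ [_ /(_ _ iS) ->]]; rewrite ffunE.
- exists (S None); first by apply: (T_S [::]); case.
  by have := mP None; rewrite /S; case: (m None) => [[S1 nx1] od] [_ []].
- move=> t Tt t0; have [x xt] : exists x, nodeat t = Some x.
    by case/lastP: t t0 {Tt} => // t i _; rewrite nodeat_rcons; eexists.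
  have := mP (nodeat t); case mt: (m (nodeat t)) => [[S1 nx1] [d|]] /=; rewrite xt; last by case.
  move=> [S1n0 [S1f nx1P]]; exists d; split.
  + move=> i /T_rcons[_ /andP[_]]; rewrite /S mt /= => /nx1P[_ nxi] d'.
    have vE : v (rcons t i) = pos (nx1 (lab i)) by rewrite /v nodeat_rcons /nx mt.
    by rewrite vE nxi /v xt ffunE.
  (* Child indices lie below [#|state A|], which bounds the branching. *)
  + exists [seq i <- iota 0 #|state A| | ok (nodeat t) i]; split.
    * by rewrite filter_uniq // iota_uniq.
    * move=> i; rewrite mem_filter mem_iota add0n leq0n /=.
      split=> [/T_rcons[_ oki]|/andP[oki _]]; last exact/T_rcons.
      by rewrite oki; case/andP: oki.
    * rewrite size_filter (leq_trans (count_size _ _)) ?size_iota // andbT -has_count.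
      have [q] := set0Pn _ S1n0; rewrite (_ : S1 = S (nodeat t)); last by rewrite /S mt.
      case/ok_ex=> i oki _; apply/hasP; exists i => //.
      by rewrite mem_iota; case/andP: oki.
  + exists (S (nodeat t)); first exact: T_S.
    by rewrite /S mt /v xt.
- move=> pi Tpi.
  have nodeat_pi k : exists x, nodeat (mkseq pi k.+1) = Some x.
    by rewrite mkseqS nodeat_rcons; eexists.
  have [p pE] := choice_fun nodeat_pi.
  have edgep k : edge (p k) (p k.+1).
    have := mP (nodeat (mkseq pi k.+1)).
    have := pE k.+1; rewrite mkseqS nodeat_rcons /nx => -[].
    have /T_rcons[_ /andP[_]] : T (rcons (mkseq pi k.+1) (pi k.+1)) by rewrite -mkseqS.
    rewrite /S pE; case: (m _) => [[S1 nx1] [d|]] /=; last by move=> _ _ [].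
    by move=> piS <- [_ [_ /(_ _ piS)[]]].
  have [p0 [io least even]] :
      parity_acc false (fun k => prio (v (mkseq pi k)).1).
    (* Shifted by one: the path begins at the root, the play at a child of it. *)
    apply: (@parity_acc_suffix _ _ (fun k => prio (pos (p k)).1) 1) => [k|].
      by rewrite addn1 /v pE.
    exact: strategy_acc edgep.
  by exists p0; split=> //; rewrite even.
Qed.

Lemma langE : lang A w <-> force (init A) (fun q => accepts_from (q, start)).
Proof. by split; [apply: lang_force | apply: force_lang]. Qed.

End AcceptanceGame.

(** * Substitution and duality of formulas, and counting subformulas *)

Fixpoint pbf_bind (Q R : Type) (g : Q -> pbf R) (f : pbf Q) : pbf R :=
  match f with
  | PTrue => PTrue
  | PFalse => PFalse
  | PAtom q => g q
  | PAnd f1 f2 => PAnd (pbf_bind g f1) (pbf_bind g f2)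
  | POr f1 f2 => POr (pbf_bind g f1) (pbf_bind g f2)
  end.

Fixpoint pbf_dual (Q : Type) (f : pbf Q) : pbf Q :=
  match f with
  | PTrue => PFalse
  | PFalse => PTrue
  | PAtom q => PAtom q
  | PAnd f1 f2 => POr (pbf_dual f1) (pbf_dual f2)
  | POr f1 f2 => PAnd (pbf_dual f1) (pbf_dual f2)
  end.

Definition pbf_all (I Q : Type) (s : seq I) (g : I -> pbf Q) : pbf Q :=
  foldr (fun i f => PAnd (g i) f) PTrue s.

Definition pbf_any (I Q : Type) (s : seq I) (g : I -> pbf Q) : pbf Q :=
  foldr (fun i f => POr (g i) f) PFalse s.

Lemma sat_bind (Q R : finType) (g : Q -> pbf R) (S : {set R}) (f : pbf Q) :
  sat S (pbf_bind g f) = sat [set q | sat S (g q)] f.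
Proof. by elim: f => //= [q|f1 -> f2 ->|f1 -> f2 ->] //; rewrite inE. Qed.

Lemma sat_dual (Q : finType) (S : {set Q}) (f : pbf Q) :
  sat S (pbf_dual f) = ~~ sat (~: S) f.
Proof.
elim: f => //= [q|f1 -> f2 ->|f1 -> f2 ->]; first by rewrite inE negbK.
  by rewrite negb_and.
by rewrite negb_or.
Qed.

Lemma sat_all (I : Type) (Q : finType) (S : {set Q}) (s : seq I) (g : I -> pbf Q) :
  sat S (pbf_all s g) = all (fun i => sat S (g i)) s.
Proof. by elim: s => //= i s ->. Qed.

Lemma sat_any (I : Type) (Q : finType) (S : {set Q}) (s : seq I) (g : I -> pbf Q) :
  sat S (pbf_any s g) = has (fun i => sat S (g i)) s.
Proof. by elim: s => //= i s ->. Qed.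

Lemma mem_subformulas (Q : eqType) (f : pbf Q) : f \in subformulas f.
Proof. by case: f => *; rewrite mem_head. Qed.

(** Only atoms bring in subformulas that are not instances of old ones. Collecting these in a fixed
    [L] lets them be counted once for all formulas. *)
Lemma subformulas_bind (Q R : eqType) (g : Q -> pbf R) (L : seq (pbf R)) (f : pbf Q) :
  (forall q, {subset subformulas (g q) <= L}) ->
  {subset subformulas (pbf_bind g f) <= [seq pbf_bind g h | h <- subformulas f] ++ L}.
Proof.
move=> gL; elim: f => [||q|f1 IH1 f2 IH2|f1 IH1 f2 IH2] h /=.
1,2: by rewrite !inE => ->.
- by move/gL=> hL; rewrite inE hL orbT.
all: rewrite !inE map_cat !mem_cat => /or3P[->//|/IH1|/IH2];
  by rewrite mem_cat => /orP[]->; rewrite ?orbT.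
Qed.

Lemma subformulas_dual (Q : Type) (f : pbf Q) :
  subformulas (pbf_dual f) = map (@pbf_dual Q) (subformulas f).
Proof. by elim: f => //= f1 -> f2 ->; rewrite map_cat. Qed.

Lemma subformulas_all (I Q : eqType) (s : seq I) (g : I -> pbf Q) i :
  i \in s -> {subset subformulas (g i) <= subformulas (pbf_all s g)}.
Proof.
elim: s => //= j s IHs; rewrite inE => /predU1P[->|/IHs gs] h hg.
  by rewrite inE mem_cat hg orbT.
by rewrite inE mem_cat gs ?orbT.
Qed.

Lemma subformulas_any (I Q : eqType) (s : seq I) (g : I -> pbf Q) i :
  i \in s -> {subset subformulas (g i) <= subformulas (pbf_any s g)}.
Proof.
elim: s => //= j s IHs; rewrite inE => /predU1P[->|/IHs gs] h hg.
  by rewrite inE mem_cat hg orbT.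
by rewrite inE mem_cat gs ?orbT.
Qed.

Lemma size_subformulas_all (I Q : Type) (s : seq I) (g : I -> pbf Q) k :
  (forall i, size (subformulas (g i)) = k) ->
  size (subformulas (pbf_all s g)) = (size s * k.+1).+1.
Proof. by move=> gk; elim: s => //= i s IHs; rewrite size_cat gk IHs; lia. Qed.

Lemma size_subformulas_any (I Q : Type) (s : seq I) (g : I -> pbf Q) k :
  (forall i, size (subformulas (g i)) = k) ->
  size (subformulas (pbf_any s g)) = (size s * k.+1).+1.
Proof. by move=> gk; elim: s => //= i s IHs; rewrite size_cat gk IHs; lia. Qed.

Definition all_subformulas n Sigma (A : aapa n Sigma) : seq (pbf (state A)) :=
  undup (flatten (map (@subformulas (state A)) (formulas A))).

Lemma mem_all_subformulas n Sigma (A : aapa n Sigma) f :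
  f \in formulas A -> {subset subformulas f <= all_subformulas A}.
Proof.
by move=> fA h hf; rewrite mem_undup; apply/flattenP; exists (subformulas f); rewrite ?map_f.
Qed.

Lemma init_formula n Sigma (A : aapa n Sigma) : init A \in formulas A.
Proof. exact: mem_head. Qed.

Lemma trans_formula n Sigma (A : aapa n Sigma) q a d : trans q a d \in formulas A.
Proof.
rewrite inE; apply/orP; right; apply/imageP.
by exists (q, a, d).
Qed.

(** A duplicate-free list is no longer than any list covering it; this bounds the size of the
    constructed automata. *)
Lemma size_all_subformulas n Sigma (A : aapa n Sigma) L :
  {subset subformulas (init A) <= L} ->
  (forall q a d, {subset subformulas (trans (a := A) q a d) <= L}) ->
  size (all_subformulas A) <= size L.
Proof.
move=> initL transL; apply: uniq_leq_size; first exact: undup_uniq.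
move=> h; rewrite mem_undup => /flattenP[_ /mapP[f + ->] hf].
rewrite inE => /predU1P[fE|/imageP[[[q a] d] _ fE]].
  by apply: initL; rewrite -fE.
by apply: (transL q a d); rewrite -fE.
Qed.

Lemma aapa_sizeE n Sigma (A : aapa n Sigma) : aapa_size A =
  #|state A| + (max_prio A).+1 + #|state A| * #|Sigma| * n + size (all_subformulas A).
Proof. by []. Qed.

(** * Union and intersection *)

Section Embedding.
Variables (Q R : finType) (e : Q -> R).

Definition embed (f : pbf Q) : pbf R :=
  PAnd (pbf_bind (fun q => PAtom (e q)) f) (pbf_any (enum Q) (fun q => PAtom (e q))).

(** The added disjunction puts a state of the image of [e] into [S], so the preimage of [S] is
    non-empty; states outside the image are dropped. *)
Lemma force_embed (f : pbf Q) (Z : R -> Prop) :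
  force (embed f) Z <-> force f (fun q => Z (e q)).
Proof.
split=> -[S [S0 Sf SZ]].
  move: Sf; rewrite /= sat_bind sat_any => /andP[Sf /hasP[q _ /= qS]].
  exists [set q | e q \in S]; split=> // [|q']; last by rewrite inE; apply: SZ.
  by apply/set0Pn; exists q; rewrite inE.
have [q qS] := set0Pn _ S0.
exists (e @: S); split=> [||_ /imsetP[q' q'S ->]]; last exact: SZ.
  by apply/set0Pn; exists (e q); apply: imset_f.
rewrite /= sat_bind sat_any; apply/andP; split.
  by apply: sat_mono Sf; apply/subsetP=> q' q'S; rewrite inE /= imset_f.
by apply/hasP; exists q; rewrite ?mem_enum //= imset_f.
Qed.

End Embedding.

Lemma force_or (Q : finType) (f g : pbf Q) Z :
  force (POr f g) Z <-> force f Z \/ force g Z.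
Proof.
split=> [[S [S0 /= /orP[]]]|[] [S [S0 Sf SZ]]]; last 2 first.
- by exists S; split=> //=; rewrite Sf.
- by exists S; split=> //=; rewrite Sf orbT.
all: by [left; exists S | right; exists S].
Qed.

Lemma force_and (Q : finType) (f g : pbf Q) Z :
  force (PAnd f g) Z <-> force f Z /\ force g Z.
Proof.
split=> [[S [S0 /= /andP[Sf Sg] SZ]]|[[S [S0 Sf SZ]] [S' [S'0 Sg S'Z]]]].
  by split; exists S.
exists (S :|: S'); split.
- by rewrite setU_eq0 negb_and S0.
- by rewrite /= (sat_mono _ Sf) ?subsetUl // (sat_mono _ Sg) ?subsetUr.
- by move=> q; rewrite inE => /orP[/SZ|/S'Z].
Qed.

(** Up to [e] both games have the same moves and priorities, so each simulates the other with shift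
    0. *)
Lemma accepts_from_embed n Sigma (A B : aapa n Sigma) (e : state A -> state B) w :
  (forall q, prio (e q) = prio q :> nat) ->
  (forall q a d, trans (e q) a d = embed e (trans q a d)) ->
  forall q c, accepts_from w (e q, c) <-> accepts_from w (q, c).
Proof.
move=> prioE transE q c; split.
- apply: (wins_simulation (e := 0)
    (R := fun (v : position B) (v' : position A) => v = (e v'.1, v'.2))) => //.
  + exact: run_move_mono.
  + exact: run_move_mono.
  + by move=> _ v' ->; rewrite addn0 /position_prio /= prioE.
  + move=> _ v' X -> [d]; rewrite /= transE => /force_embed Fd; exists d.
    by apply: force_mono Fd => q' Xq'; right; exists (e q', advance v'.2 d).
- apply: (wins_simulation (e := 0)
    (R := fun (v : position A) (v' : position B) => v' = (e v.1, v.2))) => //.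
  + exact: run_move_mono.
  + exact: run_move_mono.
  + by move=> v _ ->; rewrite addn0 /position_prio /= prioE.
  + move=> v _ X -> [d Fd]; exists d; rewrite /= transE; apply/force_embed.
    by apply: force_mono Fd => q' Xq'; right; exists (q', advance v.2 d).
Qed.

Section Sum.
Variables (n : nat) (Sigma : finType) (A1 A2 : aapa n Sigma).

Let state12 : finType := (state A1 + state A2)%type.

Lemma sum_state_nonempty : 0 < #|state12|.
Proof. by rewrite card_sum addn_gt0 state_nonempty. Qed.

(** Only the initial formula combines the two automata. [inord] changes no priority, as the new
    bound is the larger of the two. *)
Definition sum_aapa (op : pbf state12 -> pbf state12 -> pbf state12) : aapa n Sigma :=
  @Aapa n Sigma state12 sum_state_nonempty (maxn (max_prio A1) (max_prio A2))
    (op (embed inl (init A1)) (embed inr (init A2)))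
    (fun q a d => match q with
      | inl q => embed inl (trans q a d) | inr q => embed inr (trans q a d) end)
    (fun q => match q with
      | inl q => inord (prio q) | inr q => inord (prio q) end).

Variable op : pbf state12 -> pbf state12 -> pbf state12.
Let A := sum_aapa op.

Lemma accepts_from_inl w q c :
  accepts_from (A := A) w (inl q, c) <-> accepts_from w (q, c).
Proof.
apply: (accepts_from_embed (B := A) (e := inl)) => // {}q.
by rewrite /= inordK // ltnS leq_max -ltnS ltn_ord.
Qed.

Lemma accepts_from_inr w q c :
  accepts_from (A := A) w (inr q, c) <-> accepts_from w (q, c).
Proof.
apply: (accepts_from_embed (B := A) (e := inr)) => // {}q.
by rewrite /= inordK // ltnS leq_max orbC -ltnS ltn_ord.
Qed.

Lemma sum_aapa_size :
  (forall f g, subformulas (op f g) = op f g :: subformulas f ++ subformulas g) ->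
  aapa_size A <= 3 * (aapa_size A1 + aapa_size A2).
Proof.
move=> subop.
(* The disjunction of all states is shared by all embedded formulas and has [2 * #|state B| + 1]
   subformulas. Together with the states themselves it accounts for the factor 3. *)
pose L (B : aapa n Sigma) (e : state B -> state12) :=
  [seq pbf_bind (fun q => PAtom (e q)) h | h <- all_subformulas B] ++
  [seq embed e h | h <- all_subformulas B] ++
  subformulas (pbf_any (enum (state B)) (fun q => PAtom (e q))).
have subL (B : aapa n Sigma) e f :
    f \in formulas B -> {subset subformulas (embed e f) <= L B e}.
  move=> fB h /=; rewrite inE => /predU1P[->|].
    rewrite !mem_cat (map_f (embed e)) ?orbT //.
    exact: mem_all_subformulas fB _ (mem_subformulas f).
  rewrite mem_cat => /orP[/subformulas_bind hf|hany]; last by rewrite !mem_cat hany !orbT.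
  have /hf : forall q, {subset subformulas (PAtom (e q)) <=
      subformulas (pbf_any (enum (state B)) (fun q => PAtom (e q)))}.
    by move=> q; apply: (subformulas_any (g := fun q => PAtom (e q))); rewrite mem_enum.
  rewrite !mem_cat => /orP[/mapP[g gf ->]|->]; last by rewrite !orbT.
  by rewrite map_f //; apply: mem_all_subformulas gf.
have sizeL (B : aapa n Sigma) e : size (L B e) <=
    2 * size (all_subformulas B) + 2 * #|state B| + 1.
  rewrite !size_cat !size_map (size_subformulas_any _ (k := 1)) // -cardE.
  by rewrite addnA addnn -mul2n addn1 addnS (mulnC #|_|).
have leA : size (all_subformulas A) <= size (init A :: L A1 inl ++ L A2 inr).
  apply: size_all_subformulas => [h|[q|q] a d h].
  - rewrite (subop (embed inl (init A1)) (embed inr (init A2))) in_cons mem_cat.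
    case/or3P=> [hE|h1|h2]; rewrite in_cons mem_cat; apply/or3P.
    + exact: Or31.
    + by apply: Or32; apply: subL (init_formula A1) _ h1.
    + by apply: Or33; apply: subL (init_formula A2) _ h2.
  - move=> hq; rewrite in_cons mem_cat; apply/or3P/Or32.
    exact: subL (trans_formula q a d) _ hq.
  - move=> hq; rewrite in_cons mem_cat; apply/or3P/Or33.
    exact: subL (trans_formula q a d) _ hq.
move: leA (sizeL A1 inl) (sizeL A2 inr); rewrite /= size_cat !aapa_sizeE /= card_sum.
rewrite !mulnDl.
move: (size (all_subformulas A)) (size (L A1 inl)) (size (L A2 inr)) => s l1 l2.
move: (size (all_subformulas A1)) (size (all_subformulas A2)) => s1 s2.
move: (#|state A1| * #|Sigma| * n) (#|state A2| * #|Sigma| * n) => t1 t2.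
move: #|state A1| #|state A2| (max_prio A1) (max_prio A2) => q1 q2 m1 m2.
lia.
Qed.

End Sum.

Lemma lang_union n Sigma (A1 A2 : aapa n Sigma) w :
  lang (sum_aapa (A1 := A1) (A2 := A2) (@POr _)) w <-> lang A1 w \/ lang A2 w.
Proof.
rewrite !langE force_or !force_embed.
by split=> -[F|F]; [left|right|left|right]; apply: force_mono F => q;
  rewrite ?accepts_from_inl ?accepts_from_inr.
Qed.

Lemma lang_inter n Sigma (A1 A2 : aapa n Sigma) w :
  lang (sum_aapa (A1 := A1) (A2 := A2) (@PAnd _)) w <-> lang A1 w /\ lang A2 w.
Proof.
rewrite !langE force_and !force_embed.
by split=> -[F1 F2]; split; [move: F1|move: F2|move: F1|move: F2];
  apply: force_mono => q; rewrite ?accepts_from_inl ?accepts_from_inr.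
Qed.

(** * Complement *)

Section Complement.
Variables (n : nat) (Sigma : finType) (A : aapa n Sigma).
Implicit Types (f : pbf (state A)) (c : {ffun 'I_n -> nat}).

Let cstate : finType := option (state A * 'I_n).

Definition all_directions (q : state A) : pbf cstate :=
  pbf_all (enum 'I_n) (fun d => PAtom (Some (q, d))).

(** The second disjunct is the dual of non-emptiness, that is, of the disjunction of all states. *)
Definition dual_formula f : pbf cstate :=
  POr (pbf_bind all_directions (pbf_dual f)) (pbf_all (enum (state A)) all_directions).

Lemma sat_all_directions (S : {set cstate}) q :
  reflect (forall d, Some (q, d) \in S) (sat S (all_directions q)).
Proof.
rewrite sat_all; apply: (iffP allP) => Sq d; last by move=> _; apply: Sq.
by apply: Sq; rewrite mem_enum.
Qed.

Lemma sat_dual_formula (S : {set cstate}) f :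
  let Y := [set q | sat S (all_directions q)] in
  sat S (dual_formula f) = ~~ (sat (~: Y) f && (~: Y != set0)).
Proof.
move=> Y; rewrite /= sat_bind sat_dual negb_and; congr (_ || _).
rewrite negbK -setCT (inj_eq (@setC_inj _)) sat_all.
apply/allP/eqP => [SY|YT q _].
  by apply/setP=> q; rewrite !inE SY // mem_enum.
by have := in_setT q; rewrite -YT inE.
Qed.

(** Each state of [S'] has a copy outside [S], so [S'] avoids the states whose conjunction holds in
    [S]. By monotonicity the remaining states satisfy [f], which refutes the dual formula. *)
Lemma force_dual_formula f (Z : cstate -> Prop) :
  force (dual_formula f) Z -> ~ force f (fun q => ~ forall d, Z (Some (q, d))).
Proof.
move=> [S [S0 + SZ]] [S' [S'0 S'f S'Z]]; rewrite sat_dual_formula => /negP; apply.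
have sS' : S' \subset ~: [set q | sat S (all_directions q)].
  apply/subsetP=> q /S'Z nZ; rewrite !inE; apply/negP=> /sat_all_directions qS.
  by apply: nZ => d; apply/SZ/qS.
rewrite (sat_mono sS' S'f) /=; apply: contraNneq S'0 => S0'.
by rewrite -subset0 -S0'.
Qed.

(** Choose all of [Z], the best choice for a monotone formula; the sink makes it non-empty. *)
Lemma not_force_dual_formula f (Z : cstate -> Prop) : Z None ->
  ~ force f (fun q => ~ forall d, Z (Some (q, d))) -> force (dual_formula f) Z.
Proof.
move=> Z0 nf.
pose S : {set cstate} :=
  [set x | if excluded_middle_informative (Z x) is left _ then true else false].
have SZ x : x \in S <-> Z x.
  by rewrite inE; case: excluded_middle_informative.
exists S; split=> [||x /SZ//]; first by apply/set0Pn; exists None; apply/SZ.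
rewrite sat_dual_formula; apply/negP=> /andP[Yf Y0]; apply: nf.
exists (~: [set q | sat S (all_directions q)]); split=> // q.
by rewrite !inE => /negP nq Zq; apply/nq/sat_all_directions => d; apply/SZ.
Qed.

Lemma cstate_nonempty : 0 < #|cstate|.
Proof. by rewrite card_option. Qed.

Definition complement : aapa n Sigma :=
  @Aapa n Sigma cstate cstate_nonempty (max_prio A).+1 (dual_formula (init A))
    (fun x a d => match x with
      | Some (q, d') => if d' == d then dual_formula (trans q a d) else PFalse
      | None => PTrue end)
    (fun x => if x is Some (q, _) then inord (prio q).+1 else ord0).

Variable w : nat -> n.-tuple Sigma.

Lemma accepts_from_sink c : 0 < n -> accepts_from (A := complement) w (None, c).
Proof.
move=> n0; right.
pose P c : position complement := (None, c).
have stepE c' : run_move w (P c')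
    (fun u => nowhere u \/ exists2 c'', True & P c'' = u).
  exists (Ordinal n0), [set None]; split=> // [|x /set1P ->].
    by apply/set0Pn; exists None; apply: set11.
  by right; exists (advance c' (Ordinal n0)).
have accE (p : nat -> {ffun 'I_n -> nat}) : (nat -> True) ->
    parity_acc false (fun k => position_prio (P (p k))).
  by move=> _; apply: (@parity_acc_least _ 0) => // N; exists N.
by exists (@Strategy _ _ _ false _ _ _ P (fun _ _ => True) (fun=> I) stepE accE), c.
Qed.

(** The forcing operator of the opponent in the game of [A]. *)
Definition universal_move (v : position A) (X : position A -> Prop) : Prop :=
  forall d, ~ force (trans v.1 (letter w v.2 d) d) (fun q => ~ X (q, advance v.2 d)).

Lemma universal_move_mono : monotone universal_move.
Proof.
move=> v X Y XY vX d Fd; apply: (vX d); apply: force_mono Fd => q nY /XY.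
exact: nY.
Qed.

Lemma accepts_from_determined v : accepts_from w v \/
  wins_all universal_move (@position_prio _ _ A) true v.
Proof.
pose F (b : bool) := if b then universal_move else run_move (A := A) w.
apply: (parity_determinacy (F := F) (m := (max_prio A).+1)) false v.
- by case; [apply: universal_move_mono | apply: run_move_mono].
- move=> [] v X /=.
    have [[d Fd]|nF] := classic (run_move w v (fun u => ~ X u)).
      by right; exists d.
    by left=> d Fd; apply: nF; exists d.
  have [|nF] := classic (run_move w v X); first by left.
  right=> d Fd; apply: nF; exists d; apply: force_mono Fd => q.
  exact: NNPP.
- by move=> v; apply: ltn_ord.
Qed.

Lemma prio_complement q d :
  prio (Some (q, d) : state complement) = (prio q).+1 :> nat.
Proof. by rewrite /= inordK // ltnS ltn_ord. Qed.

(** Simulation with shift 1, relating a state to its copies for all directions; the sink is an exit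
    already won. *)
Lemma accepts_from_complement q c : 0 < n ->
  wins_all universal_move (@position_prio _ _ A) true (q, c) ->
  forall d, accepts_from (A := complement) w (Some (q, d), c).
Proof.
move=> n0 qwin d; pose R (v : position A) (v' : position complement) :=
  exists d, v' = (Some (v.1, d), v.2).
apply: (@wins_simulation _ _ _ _ _ _ true false 1 R) qwin => //.
- exact: universal_move_mono.
- exact: run_move_mono.
- by move=> v _ [d' ->]; rewrite addn1 /position_prio prio_complement.
- move=> v _ X [d' ->] vX; exists d'; rewrite /= eqxx.
  apply: not_force_dual_formula; first by left; apply: accepts_from_sink.
  move=> Fd; apply: (vX d'); apply: force_mono Fd => q' nZ Xq'; apply: nZ => d''.
  by right; exists (q', advance v.2 d') => //; exists d''.
- by exists d.
Qed.

(** The direction chosen by the strategy for [A] at a node selects which of the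
    states [(q, d)] the play against the complement moves to. *)
Lemma accepts_from_clash q c : accepts_from w (q, c) ->
  ~ forall d, accepts_from (A := complement) w (Some (q, d), c).
Proof.
case=> [[]|[G [x0 x0q]]] cwin.
have [H HP] := uniform_strategy (@position_prio _ _ complement) false
  (run_move_mono (A := complement) (w := w)) (@everywhere _) (@nowhere _).
have [dir dirP] := choice_fun (strategy_step (s := G)).
(* Pairs of nodes where the copy carries the direction that [G] is about to read. *)
pose K := {z : node G * node H |
  pos z.2 = (Some ((pos z.1).1, dir z.1), (pos z.1).2)}.
pose E (z z' : K) := edge (proj1_sig z).1 (proj1_sig z').1 /\
  edge (proj1_sig z).2 (proj1_sig z').2.
have step z : exists z', E z z'.
  case: z => [[x y] /= yx]; apply: NNPP => noz.
  (* [H] must read [dir x], since other directions give [PFalse]; then some state chosen by [G] has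
     all its copies chosen by [H]. *)
  have [d' Fd'] := strategy_step y; move: Fd'; rewrite yx /=.
  case: eqP => [<-|_]; last by case=> S [].
  case/force_dual_formula; apply: force_mono (dirP x) => q' /= [[]|[x' xx' x'q']] Zq'.
  have [[]|[y' yy' y'q']] := Zq' (dir x').
  apply: noz; have z'P : pos y' = (Some ((pos x').1, dir x'), (pos x').2).
    by rewrite y'q' x'q'.
  by exists (exist _ (x', y') z'P).
have [nxt nxtP] := choice_fun step.
have [[]|[y0 y0q]] := HP _ (cwin (dir x0)).
have z0P : pos y0 = (Some ((pos x0).1, dir x0), (pos x0).2) by rewrite y0q x0q.
pose p k := iter k nxt (exist _ (x0, y0) z0P : K).
have pE k : E (p k) (p k.+1) by apply: nxtP.
have accG := strategy_acc (p := fun k => (proj1_sig (p k)).1) (fun k => (pE k).1).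
have accH := strategy_acc (p := fun k => (proj1_sig (p k)).2) (fun k => (pE k).2).
(* The two plays have priorities differing by one, so they cannot both be accepting. *)
suff : parity_acc true (fun k => position_prio (pos (proj1_sig (p k)).2)).
  by move/(parity_acc_uniq accH).
apply: (parity_acc_shift (K := 0) (e := 1)) accG => // k.
by rewrite addn0 addn1 (proj2_sig (p k)) /position_prio prio_complement.
Qed.

Lemma lang_complement : 0 < n -> lang complement w <-> ~ lang A w.
Proof.
move=> n0; rewrite !langE; split=> [Fc FA|nFA].
  apply: force_dual_formula Fc _; apply: force_mono FA => q.
  exact: accepts_from_clash.
apply: not_force_dual_formula; first exact: accepts_from_sink.
move=> FA; apply: nFA; apply: force_mono FA => q nc.
have [//|rej] := accepts_from_determined (q, start n).
by case: nc; apply: accepts_from_complement.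
Qed.

(** With [q] states, the copies give [q * n] and the shared conjunctions [q * (2 * n + 2)], up to
    constants. The transition table grows by a factor of at most [n + 1], and the rest of
    [3 * n + 8] absorbs the constants. *)
Lemma complement_size : aapa_size complement <= (3 * n + 8) * aapa_size A.
Proof.
pose L := [seq pbf_bind all_directions (pbf_dual f) | f <- all_subformulas A] ++
  [seq dual_formula f | f <- all_subformulas A] ++
  subformulas (pbf_all (enum (state A)) all_directions) ++ [:: PTrue; PFalse].
have subL f : f \in formulas A -> {subset subformulas (dual_formula f) <= L}.
  move=> fA h; rewrite in_cons mem_cat => /or3P[/eqP->|/subformulas_bind hf|hall].
  - rewrite !mem_cat (map_f dual_formula) ?orbT //.
    exact: mem_all_subformulas fA _ (mem_subformulas f).
  - have /hf : forall q, {subset subformulas (all_directions q) <=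
        subformulas (pbf_all (enum (state A)) all_directions)}.
      by move=> q; apply: subformulas_all; rewrite mem_enum.
    rewrite subformulas_dual -map_comp !mem_cat => /orP[/mapP[g gf ->]|->].
      by rewrite map_f //; apply: mem_all_subformulas gf.
    by rewrite !orbT.
  - by rewrite !mem_cat hall !orbT.
have leL : size (all_subformulas complement) <= size L.
  apply: size_all_subformulas => [|[[q d']|] a d /=].
  - exact: subL (init_formula A).
  - case: eqP => _; first exact: subL (trans_formula q a d).
    by move=> h; rewrite !inE !mem_cat => /eqP->; rewrite !inE !orbT.
  - by move=> h; rewrite !inE !mem_cat => /eqP->; rewrite !inE !orbT.
have sizeL : size L =
    2 * size (all_subformulas A) + #|state A| * (2 * n + 2) + 3.
  rewrite !size_cat !size_map (size_subformulas_all _ (k := 2 * n + 1)) -?cardE /=.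
    lia.
  by move=> q; rewrite (size_subformulas_all _ (k := 1)) // -cardE card_ord; lia.
move: leL; rewrite sizeL !aapa_sizeE /= card_option card_prod card_ord.
move: (state_nonempty A) (size (all_subformulas A)) (size (all_subformulas complement)).
move: #|state A| #|Sigma| (max_prio A) => q a m q0 s s' les'.
nia.
Qed.

End Complement.

(** Without directions no run exists and every language is empty, so complementation calls for
    [0 < n]. The constant for the complement depends on [n] because each state is copied once per
    direction. *)
Theorem theorem3p2 :
  (exists C : nat, forall (n : nat) (Sigma : finType), 0 < n ->
     forall A1 A2 : aapa n Sigma,
       (exists A : aapa n Sigma,
          aapa_size A <= C * (aapa_size A1 + aapa_size A2) /\
          forall w : nat -> n.-tuple Sigma,
            lang A w <-> lang A1 w \/ lang A2 w) /\
       (exists A : aapa n Sigma,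
          aapa_size A <= C * (aapa_size A1 + aapa_size A2) /\
          forall w : nat -> n.-tuple Sigma,
            lang A w <-> lang A1 w /\ lang A2 w)) /\
  (forall n : nat, 0 < n ->
   exists C : nat, forall (Sigma : finType) (A : aapa n Sigma),
     exists B : aapa n Sigma,
       aapa_size B <= C * aapa_size A /\
       forall w : nat -> n.-tuple Sigma, lang B w <-> ~ lang A w).
Proof.
split.
  exists 3 => n Sigma _ A1 A2; split.
    exists (sum_aapa (A1 := A1) (A2 := A2) (@POr _)); split; last exact: lang_union.
    exact: sum_aapa_size.
  exists (sum_aapa (A1 := A1) (A2 := A2) (@PAnd _)); split; last exact: lang_inter.
  exact: sum_aapa_size.
move=> n n0; exists (3 * n + 8) => Sigma A; exists (complement A); split.
  exact: complement_size.
by move=> w; apply: lang_complement.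
Qed.
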